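(* Let $B$ be a tropical affine torus such that $\mathrm{Pic}^0(B)$ is simple and does not admit a polarization (in particular, this applies if $n\ge2$ and $B=B(M)$ where $M\in GL(n,\mathbb{R})$ is such that $B(M^T)$ is simple and does not admit a polarization). Then $B$ admits no non-trivial tropical curves.
   Context: A tropical affine manifold of dimension $n$ is a smooth manifold with an atlas whose transition functions lie in $\mathbb{R}^n\rtimes GL(n,\mathbb{Z})$. $T^*_{\mathbb{Z}}B\subset T^*B$ is the local system of differentials of functions that are affine with integer linear part in charts; $T_{\mathbb{Z}}B\subset TB$ is the dual local system. For $M\in GL(n,\mathbb{R})$, $B(M)=\mathbb{R}^n/(M\cdot\mathbb{Z}^n)$; such manifolds are called tropical affine tori. For a tropical affine torus $B$, integration gives a pairing $H^0(B;T^*_{\mathbb{Z}}B)\otimes H_1(B;\mathbb{Z})\to\mathbb{R}$, and the tropical Picard variety is the tropical affine torus $\mathrm{Pic}^0(B)=\mathrm{Hom}(H_1(B;\mathbb{Z}),\mathbb{R})/H^0(B;T^*_{\mathbb{Z}}B)$, with integral structure given by $\mathrm{Hom}(H_1(B;\mathbb{Z}),\mathbb{Z})$; one has $\mathrm{Pic}^0(B(M))\simeq B(M^T)$. A tropical affine torus is simple if it admits no non-trivial sub-tropical affine torus (i.e. none of dimension strictly between $0$ and $n$); for $B(M)$ this means that there is no rational subspace $V\subset\mathbb{R}^n$ (one spanned by vectors in $\mathbb{Q}^n$), $0\ne V\ne\mathbb{R}^n$, with $M\cdot V$ rational. A polarization of a tropical affine torus $B$ is a homomorphism $c:H_1(B;\mathbb{Z})\to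 H^0(B;T^*_{\mathbb{Z}}B)$ such that $(\gamma_1,\gamma_2)\mapsto\int_{\gamma_1}c(\gamma_2)$ is symmetric and positive-definite on $H_1(B;\mathbb{Z})$. For $B(M)$ this is equivalent to a symmetric positive-definite matrix $g$ such that $gM$ has integer entries. A tropical curve in $B$ is a locally finite graph properly embedded in $B$ (hence compact when $B$ is compact), each edge $E$ being straight in affine charts with direction in $T_{\mathbb{Z}}B$ and carrying a weight $w_E\in\mathbb{Z}_{>0}$, such that at each vertex $v$ one has $\sum_{E_i\to v}w_{E_i}u_i=0$, the sum being over edge-ends at $v$ and $u_i$ the primitive vector of $T_{\mathbb{Z}}B$ at $v$ pointing into $E_i$. Non-trivial means non-empty (the curve contains at least one edge). *)

(* Defs.v *)
From HB Require Import structures.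
From mathcomp Require Import all_boot all_order all_algebra.
From mathcomp Require Import boolp classical_sets reals.

Set Implicit Arguments.
Unset Strict Implicit.
Unset Printing Implicit Defensive.

Import Order.TTheory GRing.Theory Num.Theory.

Local Open Scope classical_set_scope.
Local Open Scope ring_scope.

(* L is a lattice of full rank in the subspace W. *)
Definition lattice_in (R : realType) (V : vectType R) (W : {vspace V})
    (L : set V) : Prop :=
  exists (n : nat) (e : n.-tuple V),
    basis_of W e /\ L = [set v | inIntSpan e v].

(* The tropical affine torus B = V / H1. Its charts are the local inverses of
   the projection V -> B, read in a basis of the lattice TZ, so the transition
   functions are translations and the local system T_Z B is constant with
   fibre TZ. The projection V -> B is the universal cover, so that H_1(B; Z) is
   its deck group H1, v in H1 being the class of the image of a path in V
   from x to x + v. *)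
Record tropTorus (R : realType) := TropTorus {
  cover :> vectType R;
  TZ : set cover;
  H1 : set cover;
  TZ_lattice : lattice_in fullv TZ;
  H1_lattice : lattice_in fullv H1
}.

Definition dual (R : realType) (V : vectType R) := 'Hom(V, R^o).

Definition dual_lattice (R : realType) (V : vectType R) (L : set V) :
    set (dual V) :=
  [set phi | forall v, L v -> (phi v : R) \is a Num.int].

(* A global section of T^*_Z B is a constant 1-form on V that is integral on
   TZ. *)
Definition H0 (R : realType) (B : tropTorus R) : set (dual B) :=
  dual_lattice (TZ (t := B)).

(* Integral over g in H1 of the constant 1-form a. *)
Definition period (R : realType) (B : tropTorus R) (a : dual B) (g : B) : R :=
  a g.

Section DualLattice.
Variables (R : realType) (V : vectType R).

Lemma dual_latticeP (L : set V) :
  lattice_in fullv L -> lattice_in fullv (dual_lattice L).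
Proof.
case=> n [e [be ->]].
pose f i : dual V := linfun (coord e i : V -> R^o).
have fe (i j : 'I_n) : f i e`_j = (i == j)%:R :> R.
  by rewrite lfunE /= coord_free ?(basis_free be) // eq_sym.
have phiE (phi : dual V) : phi = \sum_(i < n) (phi e`_i : R) *: f i.
  apply/lfunP => v; rewrite sum_lfunE.
  rewrite {1}(coord_basis be (memvf v)) linear_sum; apply: eq_bigr => i _.
  rewrite linearZ scale_lfunE lfunE /=.
  by rewrite /GRing.scale /= mulrC.
have nthf (i : 'I_n) : [tuple f i | i < n]`_i = f i.
  by rewrite -tnth_nth tnth_mktuple.
exists n, [tuple f i | i < n]; split.
  rewrite basisEdim; apply/andP; split; last first.
    by rewrite size_tuple dimvf /dim /= muln1 -(size_basis be) dimvf.
  apply/subvP => phi _; rewrite (phiE phi); apply: memv_suml => i _.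
  by apply/memvZ/memv_span/mapP; exists i; rewrite ?mem_enum.
rewrite predeqE => phi; split=> /= [phiZ|[a ->] v [b ->]].
  have phiei (i : 'I_n) : (phi e`_i : R) \is a Num.int.
    apply: phiZ; exists [ffun j => (j == i)%:R].
    rewrite (bigD1 i) //= ffunE eqxx mulr1z big1 ?addr0 // => j /negPf ji.
    by rewrite ffunE ji mulr0z.
  exists [ffun i : 'I_n => Num.floor (phi e`_i : R)].
  rewrite {1}(phiE phi); apply: eq_bigr => i _.
  by rewrite ffunE nthf -scaler_int floorK.
rewrite sum_lfunE; apply: rpred_sum => i _.
rewrite nthf -scaler_int scale_lfunE linear_sum /=.
apply: rpredM; first exact: intr_int.
apply: rpred_sum => j _; rewrite raddfMz /= fe -mulrzr.
by apply: rpredM; rewrite ?intr_int ?natr_int.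
Qed.

End DualLattice.

(* Hom(H_1(B; Z), R) is identified with the dual space of V by restriction of
   functionals to the full lattice H1; the subgroup Hom(H_1(B; Z), Z) is then
   the dual lattice of H1, and H^0(B; T^*_Z B) acts on H_1 by integration. *)
Definition Pic0 (R : realType) (B : tropTorus R) : tropTorus R :=
  @TropTorus R (dual B) (dual_lattice (H1 (t := B))) (@H0 R B)
    (dual_latticeP (H1_lattice B)) (dual_latticeP (TZ_lattice B)).

(* The image of W in B is a sub-tropical affine torus, for the integral
   structure and the periods induced from B. Every sub-tropical affine torus of
   B is a translate of one of these. *)
Definition subtorus (R : realType) (B : tropTorus R) (W : {vspace B}) : Prop :=
  lattice_in W (TZ (t := B) `&` [set` W]) /\
  lattice_in W (H1 (t := B) `&` [set` W]).

Definition simple (R : realType) (B : tropTorus R) : Prop :=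
  forall W : {vspace B}, subtorus W -> W = 0%VS \/ W = fullv.

(* Only the values of c on H1 matter. *)
Definition polarization (R : realType) (B : tropTorus R) (c : B -> dual B) :
    Prop :=
  [/\ forall g, H1 g -> H0 (c g),
      forall g h, H1 g -> H1 h -> c (g + h) = c g + c h,
      forall g h, H1 g -> H1 h -> period (c h) g = period (c g) h &
      forall g, H1 g -> g <> 0 -> 0 < period (c g) g].

(* x and y have the same image in B. *)
Definition same_point (R : realType) (B : tropTorus R) (x y : B) : Prop :=
  H1 (y - x).

(* 0 is not primitive, since 0 = 0 *+ 2. *)
Definition primitive (R : realType) (V : vectType R) (L : set V) (u : V) :
    Prop :=
  L u /\ forall (m : nat) v, L v -> u = v *+ m -> m = 1%N.

(* Since B is compact, the underlying graph is finite and its embedding is a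
   continuous injection. The edge E is the image in B of the segment
   start E + t *: direction E, 0 <= t <= len E, of V; loops and multiple edges
   are allowed, and closed geodesics carry 2-valent vertices. At its initial
   vertex src E the primitive vector pointing into E is direction E, at its
   final vertex tgt E it is - direction E. *)
Record tropCurve (R : realType) (B : tropTorus R) := TropCurve {
  vertex : finType;
  edge : finType;
  src : edge -> vertex;
  tgt : edge -> vertex;
  pos : vertex -> B;
  start : edge -> B;
  direction : edge -> B;
  len : edge -> R;
  weight : edge -> nat;
  direction_primitive : forall E, primitive (TZ (t := B)) (direction E);
  len_gt0 : forall E, 0 < len E;
  weight_gt0 : forall E, (0 < weight E)%N;
  start_src : forall E, same_point (start E) (pos (src E));
  end_tgt : forall E,
    same_point (start E + len E *: direction E) (pos (tgt E));
  vertex_inj : forall v w, same_point (pos v) (pos w) -> v = w;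
  vertex_edge_disjoint : forall v E t, 0 < t < len E ->
    ~ same_point (start E + t *: direction E) (pos v);
  edge_inj : forall E F s t, 0 < s < len E -> 0 < t < len F ->
    same_point (start E + s *: direction E) (start F + t *: direction F) ->
    E = F /\ s = t;
  balanced : forall v,
    \sum_(E | src E == v) direction E *+ weight E
    + \sum_(E | tgt E == v) (- direction E) *+ weight E = 0
}.

Definition nontrivial (R : realType) (B : tropTorus R) (C : tropCurve B) :
    Prop :=
  inhabited (edge C).

Section StandardTorus.
Variables (R : realType) (n : nat).

Definition Zn : set 'cV[R]_n := [set k | k \is a mxOver Num.int].

Lemma ZnM_lattice (M : 'M[R]_n) :
  M \in unitmx -> lattice_in (fullv : {vspace 'cV[R]_n}) (mulmx M @` Zn).
Proof.
move=> Mu; exists n, [tuple col i M | i < n].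
have MkE (k : 'cV[R]_n) : M *m k = \sum_(i < n) k i 0 *: col i M.
  apply/colP => j; rewrite mxE summxE; apply: eq_bigr => i _.
  by rewrite !mxE mulrC.
split.
  rewrite basisEdim; apply/andP; split; last first.
    by rewrite size_tuple dimvf dim_matrix [X in (_ <= X)%N]muln1.
  apply/subvP => v _; rewrite -(mulKVmx Mu v) MkE; apply: memv_suml => i _.
  by apply/memvZ/memv_span/mapP; exists i; rewrite ?mem_enum.
rewrite predeqE => v; split=> /= [[k /mxOverP kZ <-]|[a ->]].
  exists [ffun i : 'I_n => Num.floor (k i 0)]; rewrite MkE; apply: eq_bigr => i _.
  by rewrite ffunE -tnth_nth tnth_mktuple -scaler_int floorK.
exists (\col_i (a i)%:~R).
  by apply/mxOverP => i j; rewrite !mxE intr_int.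
rewrite MkE; apply: eq_bigr => i _.
by rewrite mxE -tnth_nth tnth_mktuple scaler_int.
Qed.

Lemma Zn_lattice : lattice_in (fullv : {vspace 'cV[R]_n}) Zn.
Proof.
have := ZnM_lattice (unitmx1 R n).
suff -> : mulmx 1%:M @` Zn = Zn by [].
rewrite predeqE => v; split=> [[k kZ <-]|vZ]; first by rewrite mul1mx.
by exists v => //; rewrite mul1mx.
Qed.

(* B(M) *)
Definition torus (M : 'M[R]_n) (Mu : M \in unitmx) : tropTorus R :=
  TropTorus Zn_lattice (ZnM_lattice Mu).

Lemma unitmx_trT (M : 'M[R]_n) : M \in unitmx -> M^T \in unitmx.
Proof. by rewrite unitmx_tr. Qed.

End StandardTorus.

(* Main.v *)
Require Import Defs.
From HB Require Import structures.
From mathcomp Require Import all_boot all_order all_algebra.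
From mathcomp Require Import boolp classical_sets reals.
From mathcomp Require Import ring.

(** A tropical curve in B = V / H1 defines a bilinear form on the space of
    constant 1-forms on V, which is also the cover of Pic0 B:
    q(phi, psi) = sum_E w_E len_E phi(u_E) psi(u_E), with w_E, len_E and u_E the
    weight, the length and the direction of the edge E. It is symmetric and
    positive semi-definite, and its kernel K consists of the phi that vanish on
    all the directions u_E ([curve_form_eq0]).

    For phi integral on TZ, the balancing condition makes
    sum_E w_E phi(u_E) [E] a cycle of B, and psi |-> q(phi, psi) is integration
    over this cycle. Hence q is integral on TZ^* x H1^*, where L^* is the dual
    lattice of L ([curve_form_int]): phi |-> q(phi, -) has the integrality of a
    polarization of Pic0 B, whose periods are TZ^* and whose integral structure
    is H1^*.

    The subspace K is rational for both lattices of Pic0 B, because it is cut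
    out in two ways by integral functionals: the evaluations at the u_E, which
    are integral on TZ^*, and the q(f_i, -) for a basis (f_i) of TZ^*, which are
    integral on H1^*. So K is a subtorus ([curve_annihilator_subtorus], which
    rests on the Smith normal form through [lattice_in_kernel]). If Pic0 B is
    simple, then either K = 0 and q is a polarization, or K is everything and
    every u_E vanishes, which is impossible for a primitive vector.

    For B = B(M), the map phi |-> M^T phi, with phi read as the column of its
    coordinates, identifies Pic0 B(M) with B(M^T), and both hypotheses are
    transported along this isomorphism. *)

Set Implicit Arguments.
Unset Strict Implicit.
Unset Printing Implicit Defensive.

Import Order.TTheory GRing.Theory Num.Theory.

Local Open Scope ring_scope.

(** * Subspaces cut out by integral functionals *)

Section Lattices.
Variables (R : realType) (V : vectType R).
Implicit Types (L : set V) (W : {vspace V}).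

Lemma inIntSpan_coordP (n : nat) (e : n.-tuple V) (W : {vspace V}) (v : V) :
  basis_of W e -> v \in W ->
  inIntSpan e v <-> forall i, coord e i v \is a Num.int.
Proof.
move=> be vW; split=> [[a ->] i|vZ].
  under eq_bigr => j _ do rewrite -scaler_int.
  by rewrite coord_sum_free ?(basis_free be) ?intr_int.
exists [ffun i => Num.floor (coord e i v)].
rewrite {1}(coord_basis be vW); apply: eq_bigr => i _.
by rewrite ffunE -scaler_int floorK.
Qed.

(** Coordinate subspaces are rational. *)
Lemma lattice_in_coord_subspace (n : nat) (b : n.-tuple V) (T : {set 'I_n}) W :
  basis_of fullv b ->
  (forall v, v \in W <-> forall i, i \notin T -> coord b i v = 0) ->
  lattice_in W ([set v | inIntSpan b v] `&` [set` W])%classic.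
Proof.
move=> bb WP; pose e := [tuple b`_(enum_val i : 'I_n) | i < #|T|].
have eE (i : 'I_#|T|) : e`_i = b`_(enum_val i).
  by rewrite -tnth_nth tnth_mktuple.
have fb := basis_free bb.
have sumT (k : 'I_n -> R) : (forall i, i \notin T -> k i = 0) ->
    \sum_i k i *: b`_i = \sum_(i < #|T|) k (enum_val i) *: e`_i.
  move=> k0; rewrite (bigID (mem T)) /= [X in _ + X]big1 ?addr0; last first.
    by move=> i /k0 ->; rewrite scale0r.
  rewrite (big_enum_val (fun i : 'I_n => k i *: b`_i)).
  by apply: eq_bigr => i _; rewrite eE.
have eW (i : 'I_#|T|) : e`_i \in W.
  apply/WP => j jT; rewrite eE coord_free //; case: eqP => // ij.
  by rewrite -ij enum_valP in jT.
have be : basis_of W e.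
  rewrite /basis_of; apply/andP; split; last first.
    apply/freeP => k k0 i.
    have := congr1 (coord b (enum_val i)) k0.
    rewrite linear_sum linear0 (bigD1 i) //= linearZ /= eE coord_free //.
    rewrite eqxx /= [X in _ + X]big1 ?addr0; last first.
      move=> j ji; rewrite linearZ /= eE coord_free //.
      by rewrite (inj_eq enum_val_inj) (negPf ji) mulr0.
    by rewrite mulr1.
  rewrite eqEsubv; apply/andP; split.
    by apply/span_subvP => v /(nthP 0)[i]; rewrite size_tuple => i_lt <-;
       exact: (eW (Ordinal i_lt)).
  apply/subvP => v /WP v0; rewrite (coord_basis bb (memvf v)) sumT //.
  by apply: memv_suml => i _; apply/memvZ/memv_span/mem_nth; rewrite size_tuple.
exists #|T|, e; split=> //; rewrite predeqE => v; split=> /= [[vL vW]|ve].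
  apply/(inIntSpan_coordP be vW) => i.
  have -> : coord e i v = coord b (enum_val i) v.
    move/WP: (vW) => v0; rewrite {1}(coord_basis bb (memvf v)) sumT //.
    by rewrite coord_sum_free ?(basis_free be).
  by move/(inIntSpan_coordP bb (memvf v)): vL; apply.
have vW : v \in W.
  case: ve => a ->; apply: memv_suml => i _.
  by rewrite -scaler_int; apply: memvZ.
split=> //; case: ve => a ->; apply/(inIntSpan_coordP bb (memvf _)) => i.
rewrite linear_sum; apply: rpred_sum => j _ /=.
by rewrite -scaler_int linearZ /= eE coord_free // rpredM ?intr_int ?natr_int.
Qed.

(** Finitely many functionals that are integral on a full lattice L have a
    common kernel which is a coordinate subspace in some basis of L. In the
    Smith form A = P D Q of the matrix of their values on a basis e of L, the
    new basis is P^-1 e; the kernel is spanned by its members of index i with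
    zero i-th row in D. *)
Lemma adapted_basis L (I : finType) (f : I -> dual V) :
  lattice_in fullv L -> (forall j, dual_lattice L (f j)) ->
  exists (n : nat) (b : n.-tuple V) (T : {set 'I_n}),
    [/\ basis_of fullv b, L = [set v | inIntSpan b v]%classic &
      forall v, (forall j, f j v = 0 :> R) <->
                forall i, i \notin T -> coord b i v = 0].
Proof.
case=> n [e [be LE]] fZ; set m := #|I|.
pose A := \matrix_(i < n, j < m) Num.floor (f (enum_val j) e`_i : R).
have eL (i : 'I_n) : L e`_i.
  rewrite LE; apply/(inIntSpan_coordP be (memvf _)) => j.
  by rewrite coord_free ?(basis_free be) ?natr_int.
have AE (i : 'I_n) (j : 'I_m) : (A i j)%:~R = f (enum_val j) e`_i :> R.
  by rewrite mxE floorK //; apply: fZ.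
have [P Pu [Q Qu [d _ AD]]] := int_Smith_normal_form A.
set D := (\matrix_(i, j) _) in AD.
pose b := [tuple \sum_(k < n) e`_k *~ (invmx P i k) | i < n].
have bE (i : 'I_n) : b`_i = \sum_(k < n) e`_k *~ (invmx P i k).
  by rewrite -tnth_nth tnth_mktuple.
have ebE (k : 'I_n) : e`_k = \sum_(i < n) b`_i *~ (P k i).
  under eq_bigr => i _ do rewrite bE mulrz_suml.
  rewrite exchange_big /= (bigD1 k) //= [X in _ + X]big1 ?addr0 => [|l lk].
    under eq_bigr => i _ do rewrite -mulrzA mulrC.
    rewrite -mulrz_sumr.
    have -> : \sum_i P k i * invmx P i k = (P *m invmx P) k k by rewrite mxE.
    by rewrite mulmxV // mxE eqxx.
  under eq_bigr => i _ do rewrite -mulrzA mulrC.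
  rewrite -mulrz_sumr.
  have -> : \sum_i P k i * invmx P i l = (P *m invmx P) k l by rewrite mxE.
  by rewrite mulmxV // mxE eq_sym (negPf lk).
have bb : basis_of fullv b.
  rewrite basisEdim; apply/andP; split; last first.
    by rewrite size_tuple -(size_basis be).
  rewrite -(span_basis be); apply/span_subvP => v /(nthP 0)[i].
  rewrite size_tuple => i_lt <-; rewrite (ebE (Ordinal i_lt)).
  apply: memv_suml => j _; rewrite -scaler_int.
  by apply/memvZ/memv_span/mem_nth; rewrite size_tuple.
have fb := basis_free bb; have fe := basis_free be.
have fbE (i : 'I_n) (j : 'I_m) : f (enum_val j) b`_i = ((D *m Q) i j)%:~R :> R.
  have -> : D *m Q = invmx P *m A by rewrite AD -mulmxA mulKmx.
  rewrite bE linear_sum mxE rmorph_sum /=; apply: eq_bigr => k _.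
  by rewrite raddfMz rmorphM /= AE -[LHS]mulrzl.
exists n, b, [set i | [forall j, D i j == 0]]; split=> //.
  rewrite LE predeqE => v; split=> /=.
    case=> a ->; apply/(inIntSpan_coordP bb (memvf _)) => i.
    rewrite linear_sum; apply: rpred_sum => k _ /=.
    rewrite ebE -scaler_int linearZ /= rpredM ?intr_int //.
    under eq_bigr => l _ do rewrite -scaler_int.
    by rewrite coord_sum_free ?intr_int.
  case=> a ->; apply/(inIntSpan_coordP be (memvf _)) => i.
  rewrite linear_sum; apply: rpred_sum => k _ /=.
  rewrite bE -scaler_int linearZ /= rpredM ?intr_int //.
  under eq_bigr => l _ do rewrite -scaler_int.
  by rewrite coord_sum_free ?intr_int.
move=> v; pose y := \row_i coord b i v.
(* v is in the kernel iff y D = 0, Q being invertible, that is, iff y vanishes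
   on the nonzero rows of the diagonal matrix D. *)
have fvE (j : 'I_m) : f (enum_val j) v
    = (y *m map_mx intr D *m map_mx intr Q) 0 j :> R.
  rewrite -mulmxA -map_mxM {1}(coord_basis bb (memvf v)) linear_sum mxE.
  by apply: eq_bigr => i _; rewrite linearZ /= fbE !mxE.
have yDE j : (y *m map_mx intr D) 0 j
    = \sum_(i < n) coord b i v * (D i j)%:~R.
  by rewrite mxE; apply: eq_bigr => i _; rewrite !mxE.
split=> [fv0 i|v0 j].
  rewrite inE negb_forall => /existsP[j Dij].
  have yDQ0 : y *m map_mx intr D *m map_mx intr Q = 0.
    by apply/rowP => l; rewrite -fvE fv0 mxE.
  have yD0 : y *m map_mx intr D = 0.
    rewrite -[LHS]mulmx1 -(map_mx1 intr) -(mulmxV Qu) map_mxM mulmxA yDQ0.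
    by rewrite mul0mx.
  have := yDE j; rewrite yD0 mxE (bigD1 i) //= big1 ?addr0 => [/esym/eqP|k ki].
    by rewrite mulf_eq0 intr_eq0 (negPf Dij) orbF => /eqP.
  move: Dij; rewrite !mxE.
  case: (i =P j :> nat) => [ij _|]; last by rewrite mulr0n eqxx.
  by rewrite -ij -val_eqE /= in ki *; rewrite (negPf ki) mulr0n mulr0.
rewrite -(enum_rankK j) fvE.
suff -> : y *m map_mx intr D = 0 by rewrite mul0mx mxE.
apply/rowP => l; rewrite yDE mxE big1 // => i _.
have [|/v0 ->] := boolP (i \in [set i | [forall j, D i j == 0]]);
  last by rewrite mul0r.
by rewrite inE => /forallP/(_ l)/eqP ->; rewrite mulr0.
Qed.

Lemma lattice_in_kernel L (I : finType) (f : I -> dual V) W :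
  lattice_in fullv L -> (forall j, dual_lattice L (f j)) ->
  (forall v, v \in W <-> forall j, f j v = 0 :> R) ->
  lattice_in W (L `&` [set` W])%classic.
Proof.
move=> Ll fZ WP; have [n [b [T [bb -> vT]]]] := adapted_basis Ll fZ.
by apply: (lattice_in_coord_subspace (T := T) bb) => v; rewrite WP vT.
Qed.

End Lattices.

(** * The bidual *)

Section Evaluation.
Variables (R : realType) (V : vectType R).

(** The evaluation at v, as a function on the dual. *)
Definition eval_at (v : V) (phi : dual V) : R^o := phi v.

Lemma eval_at_is_linear v : linear (eval_at v).
Proof. by move=> a phi psi; rewrite /eval_at add_lfunE scale_lfunE. Qed.

HB.instance Definition _ v :=
  GRing.isLinear.Build R (dual V) R^o _ (eval_at v) (eval_at_is_linear v).

(** The canonical map from a vector space to its bidual. *)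
Definition bidual (v : V) : dual (dual V) := linfun (eval_at v).

Lemma bidualE v phi : bidual v phi = phi v.
Proof. by rewrite lfunE. Qed.

Lemma dual_separates (v : V) : (forall phi : dual V, phi v = 0 :> R) -> v = 0.
Proof.
move=> v0; rewrite (coord_vbasis (memvf v)) big1 // => i _.
have := v0 (linfun (coord (vbasis fullv) i : V -> R^o)).
by rewrite lfunE /= => ->; rewrite scale0r.
Qed.

End Evaluation.

(** * The bilinear form of a tropical curve *)

Section CurvePolarization.
Variables (R : realType) (B : tropTorus R) (C : tropCurve B).
Implicit Types phi psi : dual B.

(** The form q. On TZ^* x H1^* it is the value of psi on the cycle
    sum_E w_E phi(u_E) [E]. *)
Definition curve_form phi psi : R :=
  \sum_(E : edge C) (weight E)%:R * len E * (phi (direction E) : R)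
                    * (psi (direction E) : R).

(** The vector of V that represents q(phi, -) in the bidual. *)
Definition curve_period phi : B :=
  \sum_(E : edge C) ((weight E)%:R * len E * (phi (direction E) : R))
                    *: direction E.

Lemma curve_formE phi psi : curve_form phi psi = psi (curve_period phi).
Proof.
by rewrite linear_sum; apply: eq_bigr => E _; rewrite linearZ.
Qed.

Lemma curve_formC phi psi : curve_form phi psi = curve_form psi phi.
Proof. by apply: eq_bigr => E _; rewrite mulrAC. Qed.

Lemma curve_periodD phi psi :
  curve_period (phi + psi) = curve_period phi + curve_period psi.
Proof.
rewrite -big_split; apply: eq_bigr => E _ /=.
by rewrite add_lfunE mulrDr scalerDl.
Qed.

Lemma curve_form_term_ge0 phi (E : edge C) :
  0 <= (weight E)%:R * len E * (phi (direction E) : R)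
         * (phi (direction E) : R).
Proof.
rewrite -mulrA -expr2; apply: mulr_ge0; last exact: sqr_ge0.
by rewrite mulr_ge0 ?ler0n ?(ltW (len_gt0 E)).
Qed.

Lemma curve_form_ge0 phi : 0 <= curve_form phi phi.
Proof. by apply: sumr_ge0 => E _; apply: curve_form_term_ge0. Qed.

Lemma curve_form_eq0 phi :
  curve_form phi phi = 0 -> forall E : edge C, phi (direction E) = 0 :> R.
Proof.
move=> q0 E.
have := psumr_eq0P (fun E _ => curve_form_term_ge0 phi E) q0 (i := E) isT.
move/eqP; rewrite -mulrA mulf_eq0 -expr2 expf_eq0 /= mulf_eq0 pnatr_eq0.
by rewrite (gt_eqF (len_gt0 E)) -leqn0 leqNgt weight_gt0 => /eqP.
Qed.

(** Modulo integers, len_E psi(u_E) is the difference of the values of psi at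
    the two ends of E; weighted by w_E phi(u_E), these differences cancel by
    balancing when summed vertex by vertex. *)
Lemma curve_form_int phi psi :
  dual_lattice (TZ (t := B)) phi -> dual_lattice (H1 (t := B)) psi ->
  curve_form phi psi \is a Num.int.
Proof.
move=> phiZ psiZ.
pose a (E : edge C) : R := (weight E)%:R * (phi (direction E) : R).
pose p (v : vertex C) : R := psi (pos v).
have aZ E : a E \is a Num.int.
  by rewrite rpredM ?natr_int //; apply: phiZ; case: (direction_primitive E).
have edgeZ (E : edge C) :
    exists2 r : R, r \is a Num.int &
      len E * (psi (direction E) : R) = r + (p (tgt E) - p (src E)).
  have sZ := psiZ _ (start_src E); have tZ := psiZ _ (end_tgt E).
  exists ((psi (pos (src E) - start E) : R)
      - (psi (pos (tgt E) - (start E + len E *: direction E)) : R)).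
    exact: rpredB.
  rewrite !(linearB, linearD, linearZ) /= /p.
  rewrite /GRing.scale /=; ring.
have cycle0 : \sum_E a E * (p (tgt E) - p (src E)) = 0.
  under eq_bigr => E _ do rewrite mulrBr.
  rewrite sumrB (partition_big (@tgt R B C) xpredT) //=.
  rewrite [X in _ - X](partition_big (@src R B C) xpredT) //= -sumrB.
  rewrite big1 // => v _.
  have := congr1 (fun u => phi u : R) (balanced v).
  rewrite /= linearD !linear_sum linear0 /= => bal.
  under eq_bigr => E /eqP -> do [].
  under [X in _ - X]eq_bigr => E /eqP -> do [].
  rewrite -!mulr_suml -mulrBl.
  suff -> : \sum_(E | tgt E == v) a E - \sum_(E | src E == v) a E = 0.
    by rewrite mul0r.
  rewrite -[RHS]oppr0 -[in RHS]bal opprD addrC -!sumrN.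
  congr (_ + _); apply: eq_bigr => E _.
    by rewrite linearMn /= /a mulr_natl.
  by rewrite linearMn linearN /= /a mulr_natl mulNrn opprK.
have -> : curve_form phi psi
    = \sum_E a E * (len E * (psi (direction E) : R) - (p (tgt E) - p (src E))).
  under [RHS]eq_bigr => E _ do rewrite mulrBr.
  rewrite sumrB cycle0 subr0; apply: eq_bigr => E _; rewrite /a; ring.
apply: rpred_sum => E _; have [r rZ ->] := edgeZ E.
by rewrite addrK rpredM.
Qed.

(** The kernel K of the form, as the space of 1-forms that vanish on all the
    edges. *)
Definition curve_annihilator : {vspace dual B} :=
  (\bigcap_(E : edge C) lker (bidual (direction E)))%VS.

Lemma curve_annihilatorP phi :
  phi \in curve_annihilator <-> forall E : edge C, phi (direction E) = 0 :> R.
Proof.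
rewrite memvE; split=> [/subv_bigcapP phi0 E|phi0].
  by have := phi0 E isT; rewrite -memvE memv_ker bidualE => /eqP.
by apply/subv_bigcapP => E _; rewrite -memvE memv_ker bidualE; apply/eqP/phi0.
Qed.

Lemma curve_annihilator_subtorus : subtorus (B := Pic0 B) curve_annihilator.
Proof.
split.
  (* The functionals q(f_i, -) are integral on H1^*; a phi that they all kill
     satisfies q(phi, phi) = 0. *)
  have [n [f [bf fE]]] := dual_latticeP (TZ_lattice B).
  apply: (lattice_in_kernel (f := fun i : 'I_n => bidual (curve_period f`_i))).
  - exact: (TZ_lattice (Pic0 B)).
  - move=> i psi psiZ; rewrite bidualE -curve_formE.
    apply: curve_form_int => //; rewrite fE.
    apply/(inIntSpan_coordP bf (memvf _)) => j.
    by rewrite coord_free ?(basis_free bf) ?natr_int.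
  - move=> phi; rewrite curve_annihilatorP; split=> phi0.
      move=> i; rewrite bidualE -curve_formE curve_formC.
      by rewrite /curve_form big1 // => E _; rewrite phi0 mulr0 mul0r.
    apply: curve_form_eq0; rewrite curve_formE -bidualE.
    rewrite (coord_basis bf (memvf phi)) linear_sum big1 // => i _.
    rewrite linearZ /= bidualE.
    have := phi0 i; rewrite bidualE -curve_formE curve_formC curve_formE.
    by rewrite -(coord_basis bf (memvf phi)) => ->; rewrite scaler0.
apply: (lattice_in_kernel (f := fun E : edge C => bidual (direction E))).
- exact: (H1_lattice (Pic0 B)).
- move=> E phi phiZ; rewrite bidualE; apply: phiZ.
  by case: (direction_primitive E).
- move=> phi; rewrite curve_annihilatorP.
  by split=> phi0 E; have := phi0 E; rewrite bidualE.
Qed.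

Lemma curve_polarization :
  curve_annihilator = 0%VS ->
  polarization (B := Pic0 B) (fun phi => bidual (curve_period phi)).
Proof.
move=> K0; split=> [phi phiZ psi psiZ|phi psi _ _|phi psi _ _|phi _ phi_neq0].
- by rewrite bidualE -curve_formE; apply: curve_form_int.
- by apply/lfunP => chi; rewrite add_lfunE !bidualE curve_periodD linearD.
- by rewrite /period !bidualE -!curve_formE curve_formC.
- rewrite /period bidualE -curve_formE lt_def curve_form_ge0 andbT.
  apply: contra_notN phi_neq0 => /eqP/curve_form_eq0/curve_annihilatorP.
  by rewrite K0 memv0 => /eqP.
Qed.

End CurvePolarization.

Lemma no_tropCurve_of_simple_Pic0 (R : realType) (B : tropTorus R) :
  simple (Pic0 B) ->
  ~ (exists c : Pic0 B -> dual (Pic0 B), polarization c) ->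
  ~ (exists C : tropCurve B, nontrivial C).
Proof.
move=> simpleB nopol [C [E]].
have [K0|KT] := simpleB _ (curve_annihilator_subtorus C).
  by apply: nopol; eexists; apply: curve_polarization K0.
have [_ prim] := direction_primitive E.
have u0 : direction E = 0.
  apply: dual_separates => phi; move: E {prim}; apply/curve_annihilatorP.
  by rewrite KT memvf.
(* 0 is not primitive, since 0 = 0 *+ 2. *)
have TZ0 : TZ (t := B) 0.
  by rewrite -u0; case: (direction_primitive E).
by have := prim 2%N 0 TZ0; rewrite mul0rn u0 => /(_ erefl).
Qed.

(** * Isomorphisms of tropical affine tori *)

Section Isomorphism.
Variables (R : realType) (B B' : tropTorus R) (F : 'Hom(B, B')).
Hypotheses (Finj : lker F == 0%VS) (Fsurj : limg F = fullv).
Hypothesis FTZ : forall v, TZ (t := B') (F v) <-> TZ (t := B) v.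
Hypothesis FH1 : forall v, H1 (t := B') (F v) <-> H1 (t := B) v.

Let FVK : cancel (F^-1)%VF F.
Proof. by move=> v; rewrite limg_lfunVK // Fsurj memvf. Qed.

Lemma lattice_in_limg (L : set B) (L' : set B') (W : {vspace B}) :
  (forall v, L' (F v) <-> L v) -> lattice_in W (L `&` [set` W])%classic ->
  lattice_in (F @: W)%VS (L' `&` [set` (F @: W)%VS])%classic.
Proof.
move=> FL [n [e [be eE]]]; exists n, [tuple of map F e]; split.
  by apply: limg_basis_of => //; rewrite (eqP Finj) capv0.
have FeE (i : 'I_n) : (map F e)`_i = F e`_i.
  by rewrite (nth_map 0) ?size_tuple.
have spanE v : inIntSpan [tuple of map F e] (F v) <-> inIntSpan e v.
  split=> -[a aE]; exists a.
    apply: (lker0P Finj); rewrite aE linear_sum; apply: eq_bigr => i _.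
    by rewrite FeE raddfMz.
  by rewrite aE linear_sum; apply: eq_bigr => i _; rewrite raddfMz FeE.
have imgE v : (F v \in (F @: W)%VS) = (v \in W).
  by rewrite memvE -limg_line limg_ker0 // -memvE.
have LE v : L v /\ v \in W <-> inIntSpan e v.
  by have := congr1 (fun S : set B => S v) eE => /= <-.
rewrite predeqE => w; rewrite -(FVK w) /=.
by rewrite spanE -LE FL imgE.
Qed.

Lemma simple_iso : simple B' -> simple B.
Proof.
move=> simpleB' W [WTZ WH1].
have [F0|FT] := simpleB' (F @: W)%VS
    (conj (lattice_in_limg FTZ WTZ) (lattice_in_limg FH1 WH1)).
  by left; apply/eqP; rewrite -subv0 -(limg_ker0 _ _ Finj) F0 sub0v.
by right; apply/eqP; rewrite eqEsubv subvf -(limg_ker0 _ _ Finj) FT subvf.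
Qed.

(** Pushforward of a polarization along F. *)
Lemma polarization_iso (c : B -> dual B) : polarization c ->
  polarization (fun g : B' => (c (F^-1%VF g) \o F^-1)%VF).
Proof.
have H1V g : H1 g -> H1 (F^-1%VF g) by rewrite -FH1 FVK.
case=> cZ cD cC c_gt0; split=> [g Hg v vZ|g h Hg Hh|g h Hg Hh|g Hg g0].
- by rewrite comp_lfunE; apply: cZ (H1V _ Hg) _ _; rewrite -FTZ FVK.
- by rewrite linearD /= cD ?comp_lfunDl //; apply: H1V.
- by rewrite /period !comp_lfunE; apply: cC; apply: H1V.
- rewrite /period comp_lfunE; apply: c_gt0; first exact: H1V.
  by move=> g'0; apply: g0; rewrite -(FVK g) g'0 linear0.
Qed.

End Isomorphism.

(** * The isomorphism of Pic0 B(M) with B(M^T) *)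

Section PicStandard.
Variables (R : realType) (n : nat) (M : 'M[R]_n) (Mu : M \in unitmx).

(** phi |-> M^T phi, with phi read as the column of its coordinates. *)
Definition Pic0_torus_fun (phi : dual 'cV[R]_n) : 'cV[R]_n :=
  M^T *m \col_i (phi (delta_mx i 0) : R).

Lemma Pic0_torus_fun_is_linear : linear Pic0_torus_fun.
Proof.
move=> a phi psi; rewrite /Pic0_torus_fun scalemxAr -mulmxDr; congr (_ *m _).
by apply/colP => i; rewrite !mxE add_lfunE scale_lfunE.
Qed.

HB.instance Definition _ :=
  GRing.isLinear.Build R (dual 'cV[R]_n) 'cV[R]_n _ Pic0_torus_fun
    Pic0_torus_fun_is_linear.

(** The same map between the covers of Pic0 B(M) and B(M^T). *)
Definition Pic0_torus_map : 'Hom(Pic0 (torus Mu), torus (unitmx_trT Mu)) :=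
  linfun Pic0_torus_fun.

Lemma dual_colE (phi : dual 'cV[R]_n) (k : 'cV[R]_n) :
  phi k = \sum_i k i 0 * (phi (delta_mx i 0) : R) :> R.
Proof.
rewrite {1}(matrix_sum_delta k) linear_sum; apply: eq_bigr => i _.
by rewrite big_ord1 linearZ.
Qed.

Lemma Pic0_torus_mapE phi :
  Pic0_torus_map phi = \col_i (phi (M *m delta_mx i 0) : R).
Proof.
rewrite lfunE /=; apply/colP => i; rewrite !mxE dual_colE.
apply: eq_bigr => j _; rewrite !mxE; congr (_ * _).
rewrite (bigD1 i) //= big1 ?addr0 => [|k ki]; first by rewrite mxE !eqxx mulr1.
by rewrite mxE (negPf ki) mulr0.
Qed.

Lemma dual_lattice_Zn (N : 'M[R]_n) (phi : dual 'cV[R]_n) :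
  dual_lattice (mulmx N @` @Zn R n)%classic phi <->
  Zn (\col_i (phi (N *m delta_mx i 0) : R)).
Proof.
split=> [phiZ|/mxOverP phiZ v [k /mxOverP kZ <-]].
  apply/mxOverP => i j; rewrite mxE; apply: phiZ; exists (delta_mx i 0) => //.
  by apply/mxOverP => k l; rewrite mxE natr_int.
rewrite (matrix_sum_delta k) !linear_sum; apply: rpred_sum => i _ /=.
rewrite big_ord1 -scalemxAr linearZ /= rpredM //.
by have := phiZ i 0; rewrite mxE.
Qed.

Lemma lker_Pic0_torus_map : lker Pic0_torus_map == 0%VS.
Proof.
apply/lker0P => phi psi; rewrite !lfunE.
move=> /(can_inj (mulKmx (unitmx_trT Mu)))/colP E.
apply/lfunP => k; rewrite [LHS]dual_colE [RHS]dual_colE.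
by apply: eq_bigr => i _; have := E i; rewrite !mxE => ->.
Qed.

Lemma limg_Pic0_torus_map : limg Pic0_torus_map = fullv.
Proof.
apply/eqP; rewrite eqEdim subvf /=.
rewrite limg_dim_eq ?(eqP lker_Pic0_torus_map) ?capv0 //.
by rewrite !dimvf; apply/eq_leq/esym/muln1.
Qed.

Lemma Pic0_torus_map_TZ phi :
  TZ (t := torus (unitmx_trT Mu)) (Pic0_torus_map phi) <->
  TZ (t := Pic0 (torus Mu)) phi.
Proof. by rewrite Pic0_torus_mapE; apply: iff_sym; apply: dual_lattice_Zn. Qed.

(** H1 of B(M^T) is M^T Z^n, and H1 of Pic0 B(M) is the dual lattice of
    Z^n = 1 Z^n. *)
Lemma Pic0_torus_map_H1 phi :
  H1 (t := torus (unitmx_trT Mu)) (Pic0_torus_map phi) <->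
  H1 (t := Pic0 (torus Mu)) phi.
Proof.
have := dual_lattice_Zn 1%:M phi.
have -> : (mulmx 1%:M @` @Zn R n)%classic = @Zn R n.
  rewrite predeqE => v; split=> [[k kZ <-]|vZ]; first by rewrite mul1mx.
  by exists v => //; rewrite mul1mx.
move=> [H1Z ZH1]; rewrite lfunE; split=> [[k kZ kE]|phiZ].
  apply: ZH1; under eq_mx do rewrite mul1mx.
  by rewrite -(can_inj (mulKmx (unitmx_trT Mu)) kE).
exists (\col_i (phi (1%:M *m delta_mx i 0) : R)); first exact: H1Z.
by congr (_ *m _); apply/colP => i; rewrite !mxE mul1mx.
Qed.

End PicStandard.

Theorem lemma3p15 (R : realType) :
  (forall B : tropTorus R,
     simple (Pic0 B) ->
     ~ (exists c : Pic0 B -> dual (Pic0 B), polarization c) ->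
     ~ (exists C : tropCurve B, nontrivial C)) /\
  (forall (n : nat) (M : 'M[R]_n) (Mu : M \in unitmx),
     (2 <= n)%N ->
     simple (torus (unitmx_trT Mu)) ->
     ~ (exists c : torus (unitmx_trT Mu) -> dual (torus (unitmx_trT Mu)),
          polarization c) ->
     ~ (exists C : tropCurve (torus Mu), nontrivial C)).
Proof.
split=> [|n M Mu _ simpleM nopol]; first exact: no_tropCurve_of_simple_Pic0.
have inj := lker_Pic0_torus_map Mu; have surj := limg_Pic0_torus_map Mu.
have mapTZ := @Pic0_torus_map_TZ R n M Mu.
have mapH1 := @Pic0_torus_map_H1 R n M Mu.
apply: no_tropCurve_of_simple_Pic0.
  exact: simple_iso inj surj mapTZ mapH1 simpleM.
move=> [c cP]; apply: nopol.
exact (ex_intro _ _ (polarization_iso surj mapTZ mapH1 cP)).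
Qed.
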